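(* Let $F=F(x,y_0,y_1,\ldots,y_n)$ be a polynomial in $n+2$ complex variables, let $\delta=x\frac{d}{dx}$, and let $\varphi=\sum_{k=0}^{\infty}p_k(\ln x)\,x^k$, $p_k\in\mathbb{C}[t]$, be a formal Dulac series which formally satisfies the equation $F(x,y,\delta y,\ldots,\delta^n y)=0$, that is, $$F(x,\Phi):=F(x,\varphi,\delta\varphi,\ldots,\delta^n\varphi)=0.$$ Suppose that for each $j=0,\ldots,n$ one has $$\frac{\partial F}{\partial y_j}(x,\Phi)=a_j x^m+b_j(\ln x)\,x^{m+1}+\ldots,$$ where $a_j\in\mathbb{C}$, $m\in\mathbb{Z}_+$ is the same for all $j$, $b_j\in\mathbb{C}[t]$, and the dots denote terms with higher powers of $x$. If $a_n\neq 0$, then for any open sector $S$ of sufficiently small radius, with the vertex at the origin and of opening less than $2\pi$, the series $\varphi$ converges uniformly in $S$.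
   Context: A formal Dulac series is a formal expression $\sum_{k=0}^{\infty}p_k(\ln x)\,x^k$ with $p_k\in\mathbb{C}[t]$. Such series are added and multiplied as formal power series in $x$ with coefficients in $\mathbb{C}[t]$, $t=\ln x$, and equality means equality of the polynomial coefficients at each power of $x$. The derivation $\delta=x\frac{d}{dx}$ acts termwise by $\delta\bigl(p(\ln x)\,x^k\bigr)=x^k\bigl(k\,p(t)+p'(t)\bigr)|_{t=\ln x}$. $\Phi$ denotes the tuple $(\varphi,\delta\varphi,\ldots,\delta^n\varphi)$ and $\mathbb{Z}_+$ is the set of non-negative integers. Convergence in $S$ refers to the series of functions $p_k(\ln x)x^k$ on $S$, with a branch of $\ln x$ in $S$. *)

(* Defs.v *)
From HB Require Import structures.
From mathcomp Require Import all_boot all_order all_algebra.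
From mathcomp Require Import complex mpoly.
From mathcomp Require Import boolp classical_sets reals topology normedtype.
From mathcomp Require Import function_spaces sequences exp trigo.

Set Implicit Arguments.
Unset Strict Implicit.
Unset Printing Implicit Defensive.
Import Order.TTheory GRing.Theory Num.Theory.
Import numFieldNormedType.Exports.
Local Open Scope complex_scope.
Local Open Scope classical_set_scope.
Local Open Scope ring_scope.

Record fps (A : comNzRingType) := Fps { fcoef : nat -> A }.

HB.instance Definition _ (A : comNzRingType) := gen_eqMixin (fps A).
HB.instance Definition _ (A : comNzRingType) := gen_choiceMixin (fps A).

Section FpsRing.
Variable A : comNzRingType.
Implicit Types (u v w : fps A) (c : A).

Lemma fpsP u v : (forall k, fcoef u k = fcoef v k) -> u = v.
Proof. by case: u v => [u] [v] /= /funext ->. Qed.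

Definition fps_add u v := Fps (fun k => fcoef u k + fcoef v k).
Definition fps_opp u := Fps (fun k => - fcoef u k).
Definition fpsC c : fps A := Fps (fun k => if k is 0 then c else 0).
Definition fpsX : fps A := Fps (fun k => (k == 1)%:R).
Definition fps_mul u v :=
  Fps (fun k => \sum_(i < k.+1) fcoef u i * fcoef v (k - i)).

Fact fps_addA : associative fps_add.
Proof. by move=> u v w; apply: fpsP => k /=; rewrite addrA. Qed.
Fact fps_addC : commutative fps_add.
Proof. by move=> u v; apply: fpsP => k /=; rewrite addrC. Qed.
Fact fps_add0 : left_id (fpsC 0) fps_add.
Proof. by move=> u; apply: fpsP => -[|k] /=; rewrite add0r. Qed.
Fact fps_addN : left_inverse (fpsC 0) fps_opp fps_add.
Proof. by move=> u; apply: fpsP => -[|k] /=; rewrite addNr. Qed.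

Definition fps_trunc (N : nat) u : {poly A} := \poly_(i < N) fcoef u i.

Lemma coef_fps_mul N u v k : (k < N)%N ->
  fcoef (fps_mul u v) k = (fps_trunc N u * fps_trunc N v)`_k.
Proof.
move=> kN; rewrite coefM; apply: eq_bigr => i _.
by rewrite !coef_poly (leq_trans (ltn_ord i) kN) (leq_ltn_trans (leq_subr i k) kN).
Qed.

Fact fps_mulC : commutative fps_mul.
Proof.
by move=> u v; apply: fpsP => k; rewrite !(@coef_fps_mul k.+1) // mulrC.
Qed.

Lemma coef_fps_mul_trunc N u v w k : (k < N)%N ->
  fcoef (fps_mul u (fps_mul v w)) k =
  (fps_trunc N u * (fps_trunc N v * fps_trunc N w))`_k.
Proof.
move=> kN; rewrite coefM; apply: eq_bigr => i _.
have kiN : (k - i < N)%N := leq_ltn_trans (leq_subr i k) kN.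
by rewrite (coef_fps_mul _ _ kiN) coef_poly (leq_trans (ltn_ord i) kN).
Qed.

Fact fps_mulA : associative fps_mul.
Proof.
move=> u v w; apply: fpsP => k; rewrite [fps_mul (fps_mul _ _) _]fps_mulC.
by rewrite !(@coef_fps_mul_trunc k.+1) // mulrA mulrC.
Qed.

Fact fps_mul1 : left_id (fpsC 1) fps_mul.
Proof.
move=> u; apply: fpsP => k /=; rewrite big_ord_recl /= subn0 mul1r.
by rewrite big1 ?addr0 // => i _; rewrite mul0r.
Qed.

Fact fps_mulDl : left_distributive fps_mul fps_add.
Proof.
move=> u v w; apply: fpsP => k /=; rewrite -big_split /=.
by apply: eq_bigr => i _; rewrite mulrDl.
Qed.

Fact fps_1neq0 : fpsC 1 != fpsC 0.
Proof. by apply/eqP => -[] /(congr1 (@^~ 0%N)) /eqP; rewrite oner_eq0. Qed.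

HB.instance Definition _ :=
  GRing.isZmodule.Build (fps A) fps_addA fps_addC fps_add0 fps_addN.
HB.instance Definition _ := GRing.Zmodule_isComNzRing.Build (fps A)
  fps_mulA fps_mulC fps_mul1 fps_mulDl fps_1neq0.

End FpsRing.
Arguments fpsX {A}.

(* [fcoef phi k] is the polynomial p_k in t = ln x multiplying x^k. *)
Definition dulac (K : comNzRingType) := fps {poly K}.

Definition delta (K : comNzRingType) (phi : dulac K) : dulac K :=
  Fps (fun k => fcoef phi k *+ k + (fcoef phi k)^`()).

(* The arguments substituted in F: variable 0 is x and variable j + 1 is y_j,
   replaced by delta^j phi. *)
Definition jet (K : comNzRingType) (n : nat) (phi : dulac K)
    (i : 'I_n.+2) : dulac K :=
  if val i is j.+1 then iter j (@delta K) phi else fpsX.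

Definition eval_jet (K : comNzRingType) (n : nat) (F : {mpoly K[n.+2]})
    (phi : dulac K) : dulac K :=
  mmap (fun c => fpsC c%:P) (jet phi) F.

(* u = c x^m + b(ln x) x^(m+1) + terms with higher powers of x; the leading
   coefficient c is a constant, not a polynomial in ln x. *)
Definition starts_with (K : comNzRingType) (m : nat) (c : K) (b : {poly K})
    (u : dulac K) : Prop :=
  [/\ forall k, (k < m)%N -> fcoef u k = 0,
      fcoef u m = c%:P
    & fcoef u m.+1 = b].

(* The regular module C^o carries the topology and uniform structure of C. *)
Section Analytic.
Variable R : realType.
Local Notation C := R[i].

Definition expC (z : C) : C :=
  (expR (complex.Re z))%:C * (cos (complex.Im z) +i* sin (complex.Im z)).

(* Angles are not reduced modulo 2 pi: alpha and beta only fix the direction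
   and the opening beta - alpha; the branch of ln is a separate datum. *)
Definition sector (rho alpha beta : R) : set C^o :=
  [set z | exists r theta : R, [/\ 0 < r < rho, alpha < theta < beta &
     z = r%:C * (cos theta +i* sin theta)]].

(* A branch of ln is a continuous right inverse of exp on S. *)
Definition log_branch (S : set C^o) (L : C^o -> C^o) : Prop :=
  {within S, continuous L} /\ (forall z, S z -> expC (L z) = z).

Definition dulac_psum (phi : dulac C) (L : C^o -> C^o) (N : nat)
    (z : C^o) : C^o :=
  \sum_(k < N) (fcoef phi k).[L z] * z ^+ k.

Definition dulac_ucvg (phi : dulac C) (L : C^o -> C^o) (S : set C^o) : Prop :=
  exists f : C^o -> C^o, {uniform S, dulac_psum phi L @ \oo --> f}.

End Analytic.

(* Main.v *)
From HB Require Import structures.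
Require Import Defs.
From mathcomp Require Import all_boot all_order all_algebra.
From mathcomp Require Import complex mpoly.
From mathcomp Require Import boolp classical_sets reals topology normedtype.
From mathcomp Require Import function_spaces sequences exp trigo.
From mathcomp Require Import ring lra zify.
Import Order.TTheory GRing.Theory Num.Theory.
Import numFieldNormedType.Exports.
Local Open Scope classical_set_scope.
Local Open Scope ring_scope.

(* Write phi = phi0 + x^s v with phi0 a truncation of phi and s > m large.  Taylor
   expansion of F at phi0 turns the equation into
     sum_j a_j (delta + s)^j v = x Q,
   where Q is polynomial in x, ln x and the (delta + s)^j v.  Hence v_k solves
   L(k + s + d/dt) v_k = Q_(k-1), L being the polynomial with coefficients a_j, and
   Q_(k-1) only involves v_i with i < k.  First, deg v_k <= D k by induction.  Then
   weigh t^i by tau^i, with tau large compared with D: d/dt is small relative to k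
   on polynomials of degree D k, so (k + s + d/dt)^j v_k is dominated by
   L(k + s + d/dt) v_k, uniformly in k, because a_n <> 0.  The norms
   sum_(k < N) |u_k| r^k are submultiplicative and x has norm r, so for small r they
   stay at most 1 on all (delta + s)^j v, by induction on N.  Thus |v_k| <= r^(-k),
   and a degree linear in k together with |x| |ln x|^D -> 0 gives a convergent
   geometric majorant of phi. *)

Set Implicit Arguments.
Unset Strict Implicit.

(** * Taylor expansion of multivariate polynomials *)

Lemma mpoly_ring_ind (n : nat) (K : comNzRingType) (P : {mpoly K[n]} -> Prop) :
  (forall c, P c%:MP) -> (forall i, P 'X_i) ->
  (forall p q, P p -> P q -> P (p + q)) ->
  (forall p q, P p -> P q -> P (p * q)) -> forall p, P p.
Proof.
move=> PC PX PD PM; apply: mpolyind => [|c m p _ _ Pp]; first exact: PC 0.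
apply: (PD) => //; rewrite -mul_mpolyC; apply: (PM); first exact: PC.
rewrite mpolyXE_id; apply: big_ind => [||i _]; [exact: PC 1 | exact: PM |].
by elim: (m i) => [|k IH]; [exact: PC 1 | rewrite exprS; apply: PM].
Qed.

Section Taylor.
Variables (n : nat) (K A : comNzRingType) (h : {rmorphism K -> A}).
Variable S : A -> Prop.
Hypotheses (Sh : forall c, S (h c)) (SD : forall u v, S u -> S v -> S (u + v))
  (SM : forall u v, S u -> S v -> S (u * v)).
Implicit Types (F : {mpoly K[n]}) (y z : 'I_n -> A).

Lemma mmapXU y i : mmap h y 'X_i = y i.
Proof.
rewrite mmapX /mmap1 (bigD1 i) //= mnmE eqxx big1 ?mulr1 // => j /negPf.
by rewrite eq_sym mnmE => ->.
Qed.

Lemma mmap_closed y F : (forall i, S (y i)) -> S (mmap h y F).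
Proof.
move=> Sy; elim/mpoly_ring_ind: F => [c|i|p q|p q].
- by rewrite mmapC; exact: Sh.
- by rewrite mmapXU; exact: Sy.
- by rewrite mmapD; apply: SD.
- by rewrite rmorphM; apply: SM.
Qed.

(** By induction on [F] along the ring operations. The remainder is only known through its
    membership in [S]; taking [S] to be [generated V] later shows that it is a polynomial expression
    in the unknowns, without an explicit formula. *)
Lemma mmap_taylor y z e F :
    (forall i, S (y i)) -> (forall i, S (z i)) -> S e ->
  exists2 Q, S Q & mmap h (fun i => y i + e * z i) F =
    mmap h y F + e * (\sum_i mmap h y F^`M(i) * z i) + e ^+ 2 * Q.
Proof.
move=> Sy Sz Se; have S0 : S 0 by have := Sh 0; rewrite raddf0.
have Ssum G : S (\sum_i mmap h y G^`M(i) * z i).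
  by apply: big_ind => // i _; apply: SM => //; apply: mmap_closed.
elim/mpoly_ring_ind: F => [c|i|p q [Q SQ Ep] [Q' SQ' Eq]|p q [Q SQ Ep] [Q' SQ' Eq]].
- exists 0 => //; rewrite !mmapC big1 ?mulr0 ?addr0 // => i _.
  by rewrite mderivC raddf0 mul0r.
- exists 0 => //; rewrite !mmapXU mulr0 addr0 (bigD1 i) //= big1 => [|j /negPf ji].
    rewrite mderivX mnmE eqxx scale1r.
    have -> : (U_(i) - U_(i))%MM = 0%MM :> 'X_{1..n} by apply/mnmP=> j; rewrite !mnmE subnn.
    by rewrite mpolyX0 rmorph1 mul1r addr0.
  by rewrite mderivX mnmE eq_sym ji scale0r raddf0 mul0r.
- exists (Q + Q'); first exact: SD.
  under eq_bigr do rewrite mderivD mmapD mulrDl.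
  by rewrite !mmapD Ep Eq big_split /=; ring.
(* These are the terms of the product of the two expansions that carry [e ^+ 2], with that factor
   removed. *)
- exists (mmap h y p * Q' + Q * mmap h y q
      + (\sum_i mmap h y p^`M(i) * z i) * (\sum_i mmap h y q^`M(i) * z i)
      + e * ((\sum_i mmap h y p^`M(i) * z i) * Q'
             + Q * (\sum_i mmap h y q^`M(i) * z i)) + e * (e * (Q * Q'))).
    have ? := mmap_closed p Sy; have ? := mmap_closed q Sy.
    by do ![apply: SD | apply: SM].
  under eq_bigr do rewrite mderivM mmapD !rmorphM mulrDl mulrAC -[X in _ + X]mulrA.
  rewrite !rmorphM /= Ep Eq big_split /= -mulr_suml -mulr_sumr; ring.
Qed.

End Taylor.

(** * Formal power series *)

Section Fps.
Variable A : comNzRingType.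
Implicit Types u v : fps A.

(** The polynomials in x; over [{poly K}], the polynomials in x and ln x. Their weighted norms stay
    bounded as the truncation order grows. *)
Definition cofinite u := exists N, forall k, (N <= k)%N -> fcoef u k = 0.

Lemma fcoefD u v k : fcoef (u + v) k = fcoef u k + fcoef v k.
Proof. by []. Qed.

Lemma fcoefN u k : fcoef (- u) k = - fcoef u k.
Proof. by []. Qed.

Lemma fcoef0 k : fcoef (0 : fps A) k = 0.
Proof. by case: k. Qed.

Lemma fcoefM u v k : fcoef (u * v) k = \sum_(i < k.+1) fcoef u i * fcoef v (k - i).
Proof. by []. Qed.

Lemma fcoef_sum (I : Type) (r : seq I) (P : pred I) (u : I -> fps A) k :
  fcoef (\sum_(i <- r | P i) u i) k = \sum_(i <- r | P i) fcoef (u i) k.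
Proof. by apply: (big_morph (fun w => fcoef w k)) => //; exact: fcoef0. Qed.

Lemma fcoefCM c u k : fcoef (fpsC c * u) k = c * fcoef u k.
Proof.
rewrite fcoefM big_ord_recl /= subn0 big1 ?addr0 // => i _.
by rewrite mul0r.
Qed.

Lemma fcoefXnM s u k :
  fcoef (fpsX ^+ s * u) k = if (k < s)%N then 0 else fcoef u (k - s).
Proof.
elim: s k => [|s IH] k; first by rewrite mul1r subn0.
rewrite exprS -mulrA fcoefM; case: k => [|k].
  by rewrite big_ord1 mul0r.
rewrite !big_ord_recl [fcoef fpsX ord0]/= mul0r add0r big1 => [|i _].
  by rewrite mul1r addr0 IH ltnS !subSS subn0.
exact: mul0r.
Qed.

Lemma fpsXn_inj s u v : fpsX ^+ s * u = fpsX ^+ s * v -> u = v.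
Proof.
move=> E; apply: fpsP => k; have := congr1 (fun w => fcoef w (k + s)) E.
by rewrite !fcoefXnM ltnNge leq_addl addnK.
Qed.

Lemma fps_split s u : (forall k, (k < s)%N -> fcoef u k = 0) ->
  u = fpsX ^+ s * Fps (fun k => fcoef u (k + s)).
Proof.
move=> us; apply: fpsP => k; rewrite fcoefXnM.
by case: ltnP => [/us //|sk] /=; rewrite subnK.
Qed.

Lemma cofiniteC c : cofinite (fpsC c).
Proof. by exists 1%N; case. Qed.

Lemma cofiniteX : cofinite fpsX.
Proof. by exists 2%N; case=> [|[]]. Qed.

Lemma cofiniteD u v : cofinite u -> cofinite v -> cofinite (u + v).
Proof.
move=> [M uM] [N vN]; exists (maxn M N) => k; rewrite geq_max => /andP[Mk Nk].
by rewrite fcoefD uM ?vN ?addr0.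
Qed.

Lemma cofiniteN u : cofinite u -> cofinite (- u).
Proof. by move=> [M uM]; exists M => k Mk; rewrite fcoefN uM ?oppr0. Qed.

Lemma cofiniteM u v : cofinite u -> cofinite v -> cofinite (u * v).
Proof.
move=> [M uM] [N vN]; exists (M + N)%N => k MNk; rewrite fcoefM big1 // => i _.
have [/uM->|iM] := leqP M i; first by rewrite mul0r.
by rewrite vN ?mulr0 // leq_subRL ?(leq_trans (ltnW iM)) ?(leq_trans (leq_addr N M)) //
  (leq_trans _ MNk) // leq_add2r ltnW.
Qed.

Lemma cofinite_shift s u : cofinite u -> cofinite (Fps (fun k => fcoef u (k + s))).
Proof. by move=> [M uM]; exists M => k Mk /=; rewrite uM ?(leq_trans Mk) ?leq_addr. Qed.

End Fps.

(** * Dulac series and the reduced equation *)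

Section Dulac.
Variable K : comNzRingType.
Implicit Types u v w : dulac K.

Definition dulacC (c : K) : dulac K := fpsC c%:P.

Fact dulacC_zmod : zmod_morphism dulacC.
Proof. by move=> c d; apply: fpsP => -[|k] /=; rewrite ?polyCB // oppr0 addr0. Qed.
HB.instance Definition _ :=
  GRing.isZmodMorphism.Build K (dulac K) dulacC dulacC_zmod.

Fact dulacC_monoid : monoid_morphism dulacC.
Proof.
split=> [|c d]; first by [].
by apply: fpsP => k; rewrite fcoefCM; case: k => [|k] /=; rewrite ?polyCM ?mulr0.
Qed.
HB.instance Definition _ :=
  GRing.isMonoidMorphism.Build K (dulac K) dulacC dulacC_monoid.

Lemma fcoef_delta u k : fcoef (delta u) k = fcoef u k *+ k + (fcoef u k)^`().
Proof. by []. Qed.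

Lemma deltaD u v : delta (u + v) = delta u + delta v.
Proof. by apply: fpsP => k /=; rewrite mulrnDl derivD addrACA. Qed.

Lemma iter_deltaD j u v :
  iter j (@delta K) (u + v) = iter j (@delta K) u + iter j (@delta K) v.
Proof. by elim: j => //= j ->; rewrite deltaD. Qed.

Lemma cofinite_iter_delta j u : cofinite u -> cofinite (iter j (@delta K) u).
Proof.
elim: j => //= j IH /IH [N uN]; exists N => k Nk /=.
by rewrite uN // mul0rn deriv0 addr0.
Qed.

(* [shift_delta s] is [delta] conjugated by multiplication by [x^s]. *)
Definition shift_delta (s : nat) u : dulac K := delta u + u *+ s.

Lemma fcoefMn u s k : fcoef (u *+ s) k = fcoef u k *+ s.
Proof. by elim: s => [|s IH]; rewrite ?mulr0n ?fcoef0 // !mulrS fcoefD IH. Qed.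

Lemma delta_XnM s u : delta (fpsX ^+ s * u) = fpsX ^+ s * shift_delta s u.
Proof.
apply: fpsP => k; rewrite fcoef_delta !fcoefXnM; case: ltnP => sk.
  by rewrite mul0rn deriv0 addr0.
by rewrite fcoefD fcoefMn fcoef_delta addrAC -mulrnDr subnK.
Qed.

Lemma iter_delta_XnM s j u :
  iter j (@delta K) (fpsX ^+ s * u) = fpsX ^+ s * iter j (shift_delta s) u.
Proof. by elim: j => //= j ->; rewrite delta_XnM. Qed.

(** The polynomial expressions in the [V j] over the polynomials in x and ln x. As an inductive
    predicate it lets the degree and norm bounds be proved by induction on how [Q] is built. *)
Inductive generated (J : Type) (V : J -> dulac K) : dulac K -> Prop :=
| generated_cofinite u of cofinite u : generated V u
| generated_var j : generated V (V j)
| generated_add u v of generated V u & generated V v : generated V (u + v)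
| generated_mul u v of generated V u & generated V v : generated V (u * v).

Lemma generated_sum (J : Type) (V : J -> dulac K) (I : Type) (r : seq I) (u : I -> dulac K) :
  (forall i, generated V (u i)) -> generated V (\sum_(i <- r) u i).
Proof.
move=> Vu; apply: big_ind => [||i _]; last exact: Vu.
- by apply: generated_cofinite; exact: (@cofiniteC {poly K}).
- by move=> v w; apply: generated_add.
Qed.

(* Expand the equation around the truncation [phi0], where [phi = phi0 + x^s v];
   with [s > m] everything but the leading constants [a j] is pushed to
   order at least [s + m + 1]. *)
Lemma reduced_equation n (F : {mpoly K[n.+2]}) (phi : dulac K) m s
    (a : 'I_n.+1 -> K) (b : 'I_n.+1 -> {poly K}) (v : dulac K)
    (V := fun j : 'I_n.+1 => iter j (shift_delta s) v) :
    eval_jet F phi = 0 ->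
    (forall j, starts_with m (a j) (b j) (eval_jet (F^`M(lift ord0 j)) phi)) ->
    (m < s)%N ->
    v = Fps (fun k => if k is 0 then 0 else fcoef phi (k + s)) ->
  exists2 Q, generated V Q & \sum_j dulacC (a j) * V j = fpsX * Q.
Proof.
move=> F0 Fa ms vE.
(* The coefficient of index [s] goes to [phi0], so [v] and hence every [V j] has zero constant
   coefficient. *)
pose phi0 := Fps (fun k => if (k <= s)%N then fcoef phi k else 0).
pose e : dulac K := fpsX ^+ s.
(* The variable x, at index [ord0], is not perturbed. *)
pose z (i : 'I_n.+2) := if unlift ord0 i is Some j then V j else 0.
have phiE : phi = phi0 + e * v.
  apply: fpsP => k; rewrite fcoefD fcoefXnM vE /=.
  case: ltngtP => [_|sk|->]; rewrite ?addr0 ?subnn ?addr0 // add0r.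
  by rewrite subnK 1?ltnW //; move: sk; rewrite -subn_gt0; case: (k - s)%N.
have cphi0 : cofinite phi0 by exists s.+1 => k; rewrite leqNgt ltnS /= => /negPf->.
have cX : cofinite (fpsX : dulac K) by exact: cofiniteX.
have cXn k : cofinite (fpsX ^+ k : dulac K).
  by elim: k => [|k IH]; [exact: (@cofiniteC {poly K} 1) | rewrite exprS; exact: cofiniteM].
have jetE i : jet phi i = jet phi0 i + e * z i.
  rewrite /z; case: unliftP => [j ->|->]; rewrite /jet /=; last by rewrite mulr0 addr0.
  by rewrite {1}phiE iter_deltaD iter_delta_XnM.
have cy (i : 'I_n.+2) : cofinite (jet phi0 i).
  by rewrite /jet; case: (val i) => // j; apply: cofinite_iter_delta.
have V0 j : fcoef (V j) 0 = 0.
  rewrite /V; elim: (val j) => [|i IH]; first by rewrite vE.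
  by rewrite iterS fcoefD fcoefMn fcoef_delta IH !mul0rn deriv0 !addr0.
have taylor G : exists2 Q, generated V Q & eval_jet G phi = eval_jet G phi0 +
    e * (\sum_j eval_jet G^`M(lift ord0 j) phi0 * V j) + e ^+ 2 * Q.
  have Sy (i : 'I_n.+2) : generated V (jet phi0 i) by apply: generated_cofinite.
  have Sz i : generated V (z i).
    rewrite /z; case: unlift => [j|]; first exact: generated_var.
    by apply: generated_cofinite; apply: (@cofiniteC {poly K} 0).
  have [Q VQ E] := mmap_taylor (h := dulacC)
    (fun c => generated_cofinite V (cofiniteC c%:P)) (@generated_add _ V)
    (@generated_mul _ V) G Sy Sz (generated_cofinite V (cXn s)).
  exists Q => //; rewrite /eval_jet -/dulacC.
  have -> : jet phi = (fun i => jet phi0 i + e * z i) :> ('I_n.+2 -> _) by apply: funext.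
  rewrite E big_ord_recl {1}/z unlift_none mulr0 add0r.
  by congr (_ + e * _ + _); apply: eq_bigr => j _; rewrite /z liftK.
have [Q VQ] := taylor F; rewrite F0.
have ceval (G : {mpoly K[n.+2]}) : cofinite (eval_jet G phi0).
  exact: (mmap_closed (h := dulacC) (fun c => cofiniteC c%:P) (@cofiniteD _)
    (@cofiniteM _) G cy).
(* The derivatives at [phi] and at [phi0] differ only from order [s > m] on, so the latter inherits
   the leading term [a j] at order [m]; being cofinite, it leaves a cofinite rest [B]. *)
have lin j : exists2 B, cofinite B &
    eval_jet F^`M(lift ord0 j) phi0 = fpsX ^+ m * (dulacC (a j) + fpsX * B).
  set u := eval_jet _ _.
  have [Q' _ E] := taylor F^`M(lift ord0 j); rewrite expr2 -mulrA -addrA -mulrDr in E.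
  have uE k : (k <= m)%N -> fcoef (eval_jet F^`M(lift ord0 j) phi) k = fcoef u k.
    by move=> km; rewrite E fcoefD fcoefXnM (leq_ltn_trans km ms) addr0.
  have [lo mid _] := Fa j.
  exists (Fps (fun k => fcoef (u - fpsX ^+ m * dulacC (a j)) (k + m.+1))).
    apply: cofinite_shift; apply: cofiniteD; first exact: ceval.
    by apply: cofiniteN; apply: cofiniteM => //; apply: cofiniteC.
  rewrite mulrDr mulrA -exprSr -fps_split ?subrKC // => k; rewrite ltnS => km.
  rewrite fcoefD fcoefN fcoefXnM -uE //.
  have [/lo->|//|->] := ltngtP k m; first by rewrite oppr0 addr0.
    by move=> mk; rewrite leqNgt mk in km.
  by rewrite mid subnn /= subrr.
have /fin_all_exists2 [B cB EB] := lin.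
set G := eval_jet F phi0; move=> E.
(* Since [s > m], the remainder [e ^+ 2 * Q], of order at least [2s], still contains the factor
   [fpsX ^+ (s + m).+1]. *)
pose T := \sum_j B j * V j + fpsX ^+ (s - m.+1) * Q.
have EG : G = - (fpsX ^+ (s + m) * (\sum_j dulacC (a j) * V j + fpsX * T)).
  apply/eqP; rewrite -addr_eq0 eq_sym [X in X == _]E; apply/eqP.
  rewrite -addrA; congr (_ + _).
  have -> : e ^+ 2 * Q = fpsX ^+ (s + m) * (fpsX * (fpsX ^+ (s - m.+1) * Q)).
    rewrite /e -exprM !mulrA -exprSr -exprD; congr (fpsX ^+ _ * _).
    by rewrite muln2 -addnn -addnS -addnA subnKC.
  have -> : e * (\sum_j eval_jet F^`M(lift ord0 j) phi0 * V j) =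
      fpsX ^+ (s + m) * (\sum_j dulacC (a j) * V j + fpsX * (\sum_j B j * V j)).
    rewrite exprD -mulrA; congr (_ * _).
    rewrite mulr_sumr -big_split mulr_sumr.
    by apply: eq_bigr => j _; rewrite EB -mulrA mulrDl mulrA.
  rewrite /T -mulrDr; congr (_ * _); ring.
(* The equation forces the cofinite series [G] to start at order [s + m + 1] or later: by [V0] its
   coefficient at [s + m] vanishes. Its quotient [G'] is again cofinite and can be absorbed in the
   right-hand side. *)
have [G' cG' EG'] : exists2 G', cofinite G' & G = fpsX ^+ (s + m) * (fpsX * G').
  exists (Fps (fun k => fcoef G (k + (s + m).+1))); first exact/cofinite_shift/ceval.
  rewrite mulrA -exprSr -fps_split // => k; rewrite ltnS => km.
  rewrite EG fcoefN fcoefXnM; case: ltngtP km => // [_ _|-> _]; rewrite ?oppr0 //.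
  rewrite subnn fcoefD fcoef_sum big1 => [|j _].
    by rewrite -[fpsX]expr1 fcoefXnM /= addr0 oppr0.
  by rewrite fcoefCM V0 mulr0.
exists (- G' + - 1 * T).
  have c1 : cofinite (- 1 : dulac K) by apply: cofiniteN; apply: (@cofiniteC {poly K} 1).
  apply: generated_add; first by apply: generated_cofinite; apply: cofiniteN.
  apply: generated_mul; first exact: generated_cofinite.
  apply: generated_add; first apply: generated_sum => j; apply: generated_mul => //;
    by [exact: generated_cofinite | exact: generated_var].
move: EG; rewrite EG' -mulrN => /fpsXn_inj E'.
have -> : fpsX * (- G' + - 1 * T) = - (fpsX * G') - fpsX * T by ring.
by rewrite E'; ring.
Qed.

End Dulac.

(** * Weighted norms of polynomials in ln x *)

Section Norms.
Variable K : numFieldType.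
Implicit Types (p q : {poly K}) (t r c : K) (u v : dulac K).

(** The weighted l^1 norm of the coefficients, written as the value at [t] of a majorant polynomial,
    so that norm inequalities reduce to coefficientwise comparison through [le_horner]. *)
Definition pnorm t p : K := (\poly_(i < size p) `|p`_i|).[t].

Lemma coef_abs p i : (\poly_(i < size p) `|p`_i|)`_i = `|p`_i|.
Proof. by rewrite coef_poly; case: ltnP => // /leq_sizeP ->; rewrite ?normr0. Qed.

Lemma le_horner p q t : 0 <= t -> (forall i, p`_i <= q`_i) -> p.[t] <= q.[t].
Proof.
move=> t0 pq; rewrite (horner_coef_wide _ (leq_maxl (size p) (size q))).
rewrite (horner_coef_wide _ (leq_maxr (size p) (size q))).
by apply: ler_sum => i _; rewrite ler_wpM2r ?exprn_ge0.
Qed.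

Lemma pnormE t p : pnorm t p = \sum_(i < size p) `|p`_i| * t ^+ i.
Proof. by rewrite /pnorm horner_poly. Qed.

Lemma pnorm0 t : pnorm t 0 = 0.
Proof. by rewrite pnormE size_poly0 big_ord0. Qed.

Lemma pnorm_ge0 t p : 0 <= t -> 0 <= pnorm t p.
Proof. by move=> t0; rewrite pnormE sumr_ge0 // => i _; rewrite mulr_ge0 ?exprn_ge0. Qed.

Lemma pnormC t c : pnorm t c%:P = `|c|.
Proof.
rewrite pnormE size_polyC; have [->|_] /= := eqVneq c 0.
  by rewrite big_ord0 normr0.
by rewrite big_ord1 coefC mulr1.
Qed.

Lemma pnormZ t c p : pnorm t (c *: p) = `|c| * pnorm t p.
Proof.
rewrite /pnorm -hornerZ; congr _.[_]; apply/polyP => i.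
by rewrite coefZ !coef_abs coefZ normrM.
Qed.

Lemma pnormN t p : pnorm t (- p) = pnorm t p.
Proof. by rewrite -scaleN1r pnormZ normrN1 mul1r. Qed.

Lemma pnormMn t p n : pnorm t (p *+ n) = n%:R * pnorm t p.
Proof. by rewrite -scaler_nat pnormZ normr_nat. Qed.

Lemma pnormD t p q : 0 <= t -> pnorm t (p + q) <= pnorm t p + pnorm t q.
Proof.
move=> t0; rewrite /pnorm -hornerD; apply: le_horner => // i.
by rewrite coefD !coef_abs coefD ler_normD.
Qed.

Lemma pnorm_sum t (I : Type) (s : seq I) (f : I -> {poly K}) : 0 <= t ->
  pnorm t (\sum_(i <- s) f i) <= \sum_(i <- s) pnorm t (f i).
Proof.
move=> t0; elim: s => [|i s IH]; first by rewrite !big_nil pnorm0.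
by rewrite !big_cons (le_trans (pnormD _ _ t0)) ?lerD2l.
Qed.

Lemma pnormM t p q : 0 <= t -> pnorm t (p * q) <= pnorm t p * pnorm t q.
Proof.
move=> t0; rewrite /pnorm -hornerM; apply: le_horner => // i.
rewrite coef_abs !coefM (le_trans (ler_norm_sum _ _ _)) // ler_sum // => j _.
by rewrite !coef_abs normrM.
Qed.

Lemma pnorm_mono t t' p : 0 <= t <= t' -> pnorm t p <= pnorm t' p.
Proof.
move=> /andP[t0 tt']; rewrite !pnormE; apply: ler_sum => i _.
by rewrite ler_wpM2l // lerXn2r // nnegrE ?(le_trans t0).
Qed.

Lemma norm_horner_le p c : `|p.[c]| <= pnorm `|c| p.
Proof.
rewrite horner_coef pnormE (le_trans (ler_norm_sum _ _ _)) // ler_sum // => i _.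
by rewrite normrM normrX.
Qed.

Lemma pnorm_scale t p d : 1 <= t -> (size p <= d.+1)%N ->
  pnorm t p <= pnorm 1 p * t ^+ d.
Proof.
move=> t1 pd; rewrite !pnormE mulr_suml; apply: ler_sum => i _.
rewrite expr1n mulr1 ler_wpM2l // ler_weXn2l //.
by rewrite -ltnS (leq_trans (ltn_ord i)).
Qed.

(** After multiplication by the variable, differentiation multiplies the coefficient of index i by
    i, which is at most [d]. *)
Lemma pnorm_deriv t p d : 0 <= t -> (size p <= d.+1)%N ->
  pnorm t p^`() * t <= d%:R * pnorm t p.
Proof.
move=> t0 pd; rewrite /pnorm -hornerMX -hornerZ; apply: le_horner => // -[|i].
  by rewrite coefMX coefZ !coef_abs mulr_ge0.
rewrite coefMX coefZ !coef_abs /= coef_deriv normrMn -[leLHS]mulr_natl.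
have [id|di] := leqP i.+1 d; first by rewrite ler_wpM2r ?ler_nat.
by rewrite nth_default ?normr0 ?mulr0 // (leq_trans pd).
Qed.

(* The action of [shift_delta s] on the coefficient of [x^k], with [l = k + s]. *)
Definition euler (l : nat) p : {poly K} := p *+ l + p^`().

Lemma fcoef_iter_shift s j v k :
  fcoef (iter j (shift_delta s) v) k = iter j (euler (k + s)) (fcoef v k).
Proof.
elim: j => // j IH; rewrite !iterS fcoefD fcoefMn fcoef_delta IH /euler mulrnDr.
by rewrite addrAC.
Qed.

Lemma size_iter_euler l j p : (size (iter j (euler l) p) <= size p)%N.
Proof.
elim: j => //= j IH; rewrite (leq_trans (size_polyD _ _)) // geq_max.
rewrite -scaler_nat (leq_trans (size_scale_leq _ _)) //.
by rewrite (leq_trans (size_poly _ _)) // (leq_trans (leq_pred _)).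
Qed.

(** The derivative lowers degrees, so on the top coefficient [euler l] is multiplication by [l]. *)
Lemma coef_iter_euler l j p d : (size p <= d.+1)%N ->
  (iter j (euler l) p)`_d = l%:R ^+ j * p`_d.
Proof.
move=> pd; elim: j => [|j IH]; first by rewrite mul1r.
rewrite iterS coefD coefMn coef_deriv [X in _ + X *+ _]nth_default.
  by rewrite mul0rn addr0 IH exprS -mulrA mulr_natl.
exact: leq_trans (size_iter_euler _ _ _) pd.
Qed.

(** * Inversion of the indicial operator *)

Section Inversion.
Variables (n : nat) (a : 'I_n.+1 -> K) (l : nat).
Hypotheses (l2 : (2 <= l)%N) (an0 : a ord_max != 0)
  (al : 4%:R * (\sum_j `|a j|) <= l%:R * `|a ord_max|).

(* On polynomials of degree at most [d] the derivative has norm at most [d / t],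
   so the weight [t] makes it at most half of the dominant multiplication by [l]. *)
Lemma indicial_bound (t : nat) p d : (0 < t)%N -> (size p <= d.+1)%N ->
  (d.*2 <= t * l)%N -> forall j : 'I_n.+1,
  `|a ord_max| * pnorm t%:R (iter j (euler l) p) <=
  2%:R * pnorm t%:R (\sum_i a i *: iter i (euler l) p).
Proof.
move=> t0 pd dl; pose q j := iter j (euler l) p.
have tK : 0 <= t%:R :> K by [].
(* Here [l q_j = q_(j+1) - q_j'], and the derivative is at most half of the left side, hence can be
   absorbed there. *)
have step j : l%:R * pnorm t%:R (q j) <= 2%:R * pnorm t%:R (q j.+1).
  have D2 : 2%:R * pnorm t%:R (q j)^`() <= l%:R * pnorm t%:R (q j).
    rewrite -(@ler_pM2r _ t%:R) ?ltr0n // -mulrA.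
    rewrite (le_trans (ler_wpM2l _ (pnorm_deriv tK (leq_trans (size_iter_euler l j p) pd)))) //.
    rewrite mulrA [leRHS]mulrAC -!natrM ler_wpM2r ?pnorm_ge0 // ler_nat.
    by rewrite mul2n [X in (_ <= X)%N]mulnC.
  have : l%:R * pnorm t%:R (q j) <= pnorm t%:R (q j.+1) + pnorm t%:R (q j)^`().
    rewrite -pnormMn; have -> : q j *+ l = q j.+1 + - (q j)^`().
      by rewrite /q iterS /euler addrK.
    by rewrite (le_trans (pnormD _ _ tK)) // pnormN.
  move=> /(ler_wpM2l (ler0n K 2)); rewrite mulrDr => H.
  have := le_trans H (lerD (lexx _) D2).
  by rewrite mulr_natl mulr2n lerD2r.
(* As [l >= 2], the previous bound makes the norms of the iterates nondecreasing, so [q n] dominates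
   them all. *)
have up j : pnorm t%:R (q j) <= pnorm t%:R (q j.+1).
  rewrite -(@ler_pM2l _ 2%:R) // (le_trans _ (step j)) //.
  by rewrite ler_wpM2r ?pnorm_ge0 // ler_nat.
have le_top i j : (i <= j)%N -> pnorm t%:R (q i) <= pnorm t%:R (q j).
  by move=> /subnK <-; elim: (j - i)%N => // k IH; rewrite addSn (le_trans IH).
have low (i : 'I_n) : l%:R * pnorm t%:R (q i) <= 2%:R * pnorm t%:R (q n).
  by rewrite (le_trans (step _)) // ler_pM2l // le_top.
move=> j; apply: (@le_trans _ _ (`|a ord_max| * pnorm t%:R (q n))).
  by rewrite ler_wpM2l // le_top // -ltnS.
have l0 : 0 < l%:R :> K by rewrite ltr0n (leq_trans _ l2).
set T := pnorm _ (\sum_i _).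
have S1 : `|a ord_max| * pnorm t%:R (q n) <=
    T + \sum_(i < n) `|a (widen_ord (leqnSn n) i)| * pnorm t%:R (q i).
  rewrite -pnormZ.
  have -> : a ord_max *: q n = \sum_i a i *: q i +
      - \sum_(i < n) a (widen_ord (leqnSn n) i) *: q i.
    by rewrite big_ord_recr /= addrAC subrr add0r.
  rewrite (le_trans (pnormD _ _ tK)) // lerD // pnormN.
  rewrite (le_trans (pnorm_sum _ _ tK)) // ler_sum // => i _.
  by rewrite pnormZ.
(* By [low] and [al], the terms of index below [n] amount to at most half of the leading term; [S1]
   then bounds the leading term by [2 T]. *)
have S2 : l%:R * (4%:R * \sum_(i < n) `|a (widen_ord (leqnSn n) i)| * pnorm t%:R (q i))
    <= l%:R * (2%:R * (`|a ord_max| * pnorm t%:R (q n))).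
  have -> : l%:R * (4%:R * \sum_(i < n) `|a (widen_ord (leqnSn n) i)| * pnorm t%:R (q i)) =
      4%:R * \sum_(i < n) `|a (widen_ord (leqnSn n) i)| * (l%:R * pnorm t%:R (q i)).
    rewrite mulrCA; congr (_ * _); rewrite mulr_sumr.
    by apply: eq_bigr => i _; rewrite mulrCA.
  apply: (@le_trans _ _ (4%:R * \sum_(i < n)
      `|a (widen_ord (leqnSn n) i)| * (2%:R * pnorm t%:R (q n)))).
    by rewrite ler_pM2l // ler_sum // => i _; rewrite ler_wpM2l.
  rewrite -mulr_suml mulrA.
  have -> : l%:R * (2%:R * (`|a ord_max| * pnorm t%:R (q n))) =
     (l%:R * `|a ord_max|) * (2%:R * pnorm t%:R (q n)) by ring.
  rewrite ler_wpM2r ?mulr_ge0 ?pnorm_ge0 // (le_trans _ al) // ler_pM2l //.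
  by rewrite [X in _ <= X]big_ord_recr /= lerDl.
rewrite ler_pM2l // in S2.
have := le_trans (ler_wpM2l (ler0n K 4) S1).
move=> /(_ _ _); rewrite mulrDr => /(_ _ (lerD (lexx _) S2)).
have -> : 4%:R * (`|a ord_max| * pnorm t%:R (q n)) =
  2%:R * (`|a ord_max| * pnorm t%:R (q n)) + 2%:R * (`|a ord_max| * pnorm t%:R (q n)) by ring.
rewrite lerD2r (_ : 4%:R * T = 2%:R * (2%:R * T)); last by ring.
by rewrite ler_pM2l.
Qed.

(** On the constant polynomial 1, [euler l] is multiplication by [l], so a vanishing sum would make
    the bound of [indicial_bound] with j = 0 read [|a_n| <= 0]. *)
Lemma indicial_neq0 : \sum_j a j * l%:R ^+ j != 0.
Proof.
have E j : iter j (euler l) 1 = (l%:R ^+ j)%:P :> {poly K}.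
  elim: j => //= j ->.
  by rewrite /euler derivC addr0 exprS mulr_natl polyCMn.
have := @indicial_bound 1 1 0 isT (eq_leq (size_poly1 _)) isT ord0.
rewrite /= pnormC normr1 mulr1 (_ : \sum_i _ = (\sum_j a j * l%:R ^+ j)%:P).
  rewrite pnormC; case: eqP => // ->; rewrite normr0 mulr0 normr_le0.
  by rewrite (negPf an0).
rewrite rmorph_sum; apply: eq_bigr => i _.
by rewrite E -mul_polyC -polyCM.
Qed.

(** The top coefficient of [p] is multiplied by the nonzero number of [indicial_neq0], so no degree
    is lost. *)
Lemma size_indicial p : (size p <= size (\sum_i a i *: iter i (euler l) p)%R)%N.
Proof.
case: (posnP (size p)) => [->//|p0].
have pd : (size p <= (size p).-1.+1)%N by rewrite prednK.
rewrite -[X in (X <= _)%N](prednK p0) ltnNge; apply/negP => /leq_sizeP/(_ _ (leqnn _)).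
rewrite coef_sum; under eq_bigr do rewrite coefZ (coef_iter_euler _ _ pd) mulrA.
rewrite -mulr_suml => /eqP; rewrite mulf_eq0 (negPf indicial_neq0) /=.
by rewrite -lead_coefE lead_coef_eq0 -size_poly_eq0; case: (size p) p0.
Qed.

End Inversion.

(** * Norms of truncated series and growth of the solution *)

Definition fnorm t r N u : K := (\poly_(k < N) pnorm t (fcoef u k)).[r].

Lemma fnormE t r N u : fnorm t r N u = \sum_(k < N) pnorm t (fcoef u k) * r ^+ k.
Proof. by rewrite /fnorm horner_poly. Qed.

Lemma fnorm_ge0 t r N u : 0 <= t -> 0 <= r -> 0 <= fnorm t r N u.
Proof.
move=> t0 r0; rewrite fnormE sumr_ge0 // => k _.
by rewrite mulr_ge0 ?pnorm_ge0 ?exprn_ge0.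
Qed.

Lemma fnormD t r N u v : 0 <= t -> 0 <= r ->
  fnorm t r N (u + v) <= fnorm t r N u + fnorm t r N v.
Proof.
move=> t0 r0; rewrite !fnormE -big_split; apply: ler_sum => k _.
by rewrite /= -mulrDl ler_wpM2r ?exprn_ge0 ?pnormD.
Qed.

(** Coefficients of [u * v] below [N] only involve those of the factors below [N]; the other terms
    in the product of the two majorants are nonnegative. *)
Lemma fnormM t r N u v : 0 <= t -> 0 <= r ->
  fnorm t r N (u * v) <= fnorm t r N u * fnorm t r N v.
Proof.
move=> t0 r0; rewrite /fnorm -hornerM; apply: le_horner => // k.
rewrite coef_poly coefM; case: ifP => kN; last first.
  by rewrite sumr_ge0 // => i _; rewrite mulr_ge0 // coef_poly; case: ifP; rewrite ?pnorm_ge0.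
rewrite fcoefM (le_trans (pnorm_sum _ _ t0)) // ler_sum // => i _.
rewrite !coef_poly (leq_trans (ltn_ord i) kN) (leq_ltn_trans (leq_subr i k) kN).
exact: pnormM.
Qed.

Lemma fnormX t r N u : fnorm t r N.+1 (fpsX * u) = r * fnorm t r N u.
Proof.
rewrite !fnormE big_ord_recl -[fpsX]expr1 fcoefXnM pnorm0 mul0r add0r mulr_sumr.
apply: eq_bigr => k _; rewrite fcoefXnM /= /bump /= add1n subn1 /= exprS.
by rewrite mulrCA.
Qed.

(** The bound [c] is fixed before [r] and [N], so that [r] can later be taken small compared with
    [1 / c]. *)
Lemma generated_norm (J : Type) (V : J -> dulac K) Q t : 0 <= t -> generated V Q ->
  exists2 c, 0 <= c & forall r N, 0 <= r <= 1 ->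
    (forall j, fnorm t r N (V j) <= 1) -> fnorm t r N Q <= c.
Proof.
move=> t0; elim=> [u [M uM]|j|u v _ [c c0 Hc] _ [d d0 Hd]|u v _ [c c0 Hc] _ [d d0 Hd]].
- exists (\sum_(k < M) pnorm t (fcoef u k)).
    by rewrite sumr_ge0 // => k _; rewrite pnorm_ge0.
  move=> r N /andP[r0 r1] _; rewrite fnormE.
  apply: (@le_trans _ _ (\sum_(k < N) pnorm t (fcoef u k))).
    by apply: ler_sum => k _; rewrite ler_piMr ?pnorm_ge0 ?exprn_ile1.
  have [NM|/ltnW MN] := leqP N M.
    rewrite -(subnKC NM) big_split_ord /= lerDl sumr_ge0 // => k _.
    exact: pnorm_ge0.
  rewrite -(subnKC MN) big_split_ord /= [X in _ + X]big1 ?addr0 // => k _.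
  by rewrite uM ?leq_addr ?pnorm0.
- by exists 1 => // r N _; apply.
- exists (c + d) => [|r N rr VN]; first exact: addr_ge0.
  have /andP[r0 _] := rr.
  by rewrite (le_trans (fnormD _ _ _ t0 r0)) ?lerD ?Hc ?Hd.
- exists (c * d) => [|r N rr VN]; first exact: mulr_ge0.
  have /andP[r0 _] := rr.
  by rewrite (le_trans (fnormM _ _ _ t0 r0)) ?ler_pM ?fnorm_ge0 ?Hc ?Hd.
Qed.

(** In a product the slopes combine as [C i + C (k - i) = C k] and only the offsets add up. Hence
    [D] does not depend on the slope [C], which can be chosen afterwards. *)
Lemma generated_size (J : Type) (V : J -> dulac K) Q : generated V Q ->
  exists D, forall C N,
    (forall j k, (k < N)%N -> (size (fcoef (V j) k) <= (C * k).+1)%N) ->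
    forall k, (k < N)%N -> (size (fcoef Q k) <= (C * k + D).+1)%N.
Proof.
elim=> [u [M uM]|j|u v _ [c Hc] _ [d Hd]|u v _ [c Hc] _ [d Hd]].
- exists (\max_(k < M) size (fcoef u k)) => C N _ k _.
  have [kM|/uM->] := ltnP k M; last by rewrite size_poly0.
  rewrite (leq_trans (@leq_bigmax _ (fun i : 'I_M => size (fcoef u i)) (Ordinal kM))) //.
  by rewrite ltnW // ltnS leq_addl.
- by exists 0%N => C N VN k kN; rewrite addn0 VN.
- exists (maxn c d) => C N VN k kN.
  rewrite fcoefD (leq_trans (size_polyD _ _)) // geq_max.
  rewrite (leq_trans (Hc C N VN k kN)) ?(leq_trans (Hd C N VN k kN)) //.
    by rewrite ltnS leq_add2l leq_maxr.
  by rewrite ltnS leq_add2l leq_maxl.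
- exists (c + d)%N => C N VN k kN; rewrite fcoefM.
  apply: (leq_trans (size_sum _ _ _)); apply/bigmax_leqP => i _.
  rewrite (leq_trans (size_polyMleq _ _)) //.
  have ik : (i <= k)%N by rewrite -ltnS.
  have Hi := Hc C N VN i (leq_ltn_trans ik kN).
  have Hk := Hd C N VN (k - i)%N (leq_ltn_trans (leq_subr _ _) kN).
  rewrite (leq_trans (_ : _ <= ((C * i + c).+1 + (C * (k - i) + d).+1).-1)%N) //.
    by rewrite -!subn1 leq_sub2r // leq_add.
  rewrite addnS /= addSn ltnS addnACA -mulnDr subnKC //.
Qed.

Lemma solution_growth n (a : 'I_n.+1 -> K) s v (V := fun j : 'I_n.+1 => iter j (shift_delta s) v)
    Q : generated V Q -> \sum_j dulacC (a j) * V j = fpsX * Q ->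
    (2 <= s)%N -> a ord_max != 0 ->
    4%:R * (\sum_j `|a j|) <= s%:R * `|a ord_max| ->
  exists C B, 1 <= B /\ forall k, (size (fcoef v k) <= (C * k).+1)%N /\
    pnorm 1 (fcoef v k) <= B ^+ k.
Proof.
move=> VQ E s2 an0 als.
have ls k : (2 <= k + s)%N by rewrite (leq_trans s2) ?leq_addl.
have al k : 4%:R * (\sum_j `|a j|) <= (k + s)%:R * `|a ord_max|.
  by rewrite (le_trans als) // ler_wpM2r // ler_nat leq_addl.
have Ek k : \sum_j a j *: iter j (euler (k + s)) (fcoef v k) = fcoef (fpsX * Q) k.
  rewrite -E fcoef_sum; apply: eq_bigr => j _.
  by rewrite fcoefCM mul_polyC fcoef_iter_shift.
have XQ k : fcoef (fpsX * Q) k = if k is k'.+1 then fcoef Q k' else 0.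
  by rewrite -[fpsX]expr1 fcoefXnM; case: k => // k; rewrite subn1.
(* The offset given by [Q] is taken as the slope: passing from index [k] to [k + 1] adds exactly [C]
   to the degree bound. *)
have [C HC] := generated_size VQ.
have sizeV j k : (size (fcoef (V j) k) <= size (fcoef v k))%N.
  by rewrite fcoef_iter_shift size_iter_euler.
have sizev k : (size (fcoef v k) <= (C * k).+1)%N.
  elim/ltn_ind: k => k IH.
  rewrite (leq_trans (size_indicial (ls k) an0 (al k) _)) // Ek XQ.
  case: k IH => [|k] IH; first by rewrite size_poly0.
  rewrite (leq_trans (HC C k.+1 _ k _)) ?mulnS 1?addnC // => j i ik.
  by rewrite (leq_trans (sizeV _ _)) ?IH.
(* This weight gives [2 C k <= t (k + s)], as [indicial_bound] requires in degree [C k]. *)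
pose t := (C.*2).+1.
have tK : 0 <= t%:R :> K by [].
have [c c0 Hc] := generated_norm tK VQ.
have an : 0 < `|a ord_max| by rewrite normr_gt0.
(* With radius [r = 1 / B] one has [2 r c <= |a_n|], which closes the induction below; the summand 1
   ensures [r <= 1]. *)
pose B := 2%:R * c / `|a ord_max| + 1.
have B1 : 1 <= B by rewrite lerDr divr_ge0 ?mulr_ge0.
have B0 : 0 < B by rewrite (lt_le_trans ltr01).
have r01 : 0 <= B^-1 <= 1 by rewrite invr_ge0 (ltW B0) invf_le1.
have /andP[r0 r1] := r01.
(* The factor x delays [Q] by one index, so the norm of [V j] up to [N + 1] is controlled by that of
   [Q] up to [N], where the induction hypothesis applies. *)
have VN N j : fnorm t%:R B^-1 N (V j) <= 1.
  elim: N j => [|N IH] j; first by rewrite fnormE big_ord0.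
  have := Hc _ N r01 IH => QN.
  have : `|a ord_max| * fnorm t%:R B^-1 N.+1 (V j) <=
      2%:R * fnorm t%:R B^-1 N.+1 (fpsX * Q).
    rewrite !fnormE !mulr_sumr; apply: ler_sum => k _; rewrite !mulrA.
    rewrite ler_wpM2r ?exprn_ge0 // fcoef_iter_shift -Ek.
    apply: (@indicial_bound n a _ (ls k) (al k) t _ _ isT (sizev k)).
    by rewrite /t -muln2 mulnAC muln2 leq_mul ?leqnSn ?leq_addr.
  rewrite fnormX => H; rewrite -(ler_pM2l an) mulr1 (le_trans H) //.
  rewrite mulrCA mulrC ler_pdivrMr // /B mulrDr mulr1 [X in _ <= X + _]mulrC.
  by rewrite divfK ?gt_eqF // (le_trans (ler_wpM2l _ QN)) // lerDl ltW.
exists C, B; split=> // k; split=> //.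
have t1 : 1 <= t%:R :> K by rewrite ler1n.
rewrite (le_trans (pnorm_mono (fcoef v k) (_ : 0 <= 1 <= t%:R))) ?ler01 //.
(* [V ord0] is [v] itself; its coefficient of index [k] is read off as the last term of the
   truncated norm. *)
have := VN k.+1 ord0; rewrite fnormE big_ord_recr /= exprVn => H.
rewrite -[B ^+ k]mul1r -ler_pdivrMr ?exprn_gt0 // (le_trans _ H) // lerDr sumr_ge0 // => i _.
by rewrite mulr_ge0 ?exprn_ge0 ?pnorm_ge0.
Qed.

(** The condition [0 < k] leaves p_0 free: at k = 0 the degree bound would force it to be constant.
    An abstract [numFieldType] need not be archimedean, so [arch] provides the large shift. *)
Lemma dulac_growth n (F : {mpoly K[n.+2]}) (phi : dulac K) m
    (a : 'I_n.+1 -> K) (b : 'I_n.+1 -> {poly K}) :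
    (forall c : K, 0 <= c -> exists N : nat, c <= N%:R) ->
    eval_jet F phi = 0 ->
    (forall j, starts_with m (a j) (b j) (eval_jet (F^`M(lift ord0 j)) phi)) ->
    a ord_max != 0 ->
  exists (C : nat) (A B : K), [/\ 1 <= A, 1 <= B & forall k, (0 < k)%N ->
    (size (fcoef phi k) <= (C * k).+1)%N /\ pnorm 1 (fcoef phi k) <= A * B ^+ k].
Proof.
move=> arch F0 Fa an0.
have an : 0 < `|a ord_max| by rewrite normr_gt0.
have [N HN] : exists N : nat, 4%:R * (\sum_j `|a j|) / `|a ord_max| <= N%:R.
  by apply: arch; rewrite divr_ge0 ?mulr_ge0 ?sumr_ge0.
(* [N] makes [a ord_max] dominate the indicial operator, [m] gives [m < s], and 2 gives [2 <= s]. *)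
pose s := (N + m + 2)%N.
pose v : dulac K := Fps (fun k => if k is 0 then 0 else fcoef phi (k + s)).
have ms : (m < s)%N by rewrite /s; lia.
have [Q VQ E] := reduced_equation F0 Fa ms (erefl v).
have s2 : (2 <= s)%N by rewrite leq_addl.
have als : 4%:R * (\sum_j `|a j|) <= s%:R * `|a ord_max|.
  by rewrite -ler_pdivrMr // (le_trans HN) // ler_nat /s -addnA leq_addr.
have [C [B [B1 CB]]] := solution_growth VQ E s2 an0 als.
(* [D] and [A] absorb the coefficients of index at most [s], which [v] does not see. *)
pose D := \max_(k < s.+1) size (fcoef phi k).
pose A := 1 + \sum_(k < s.+1) pnorm 1 (fcoef phi k).
have sum0 : 0 <= \sum_(k < s.+1) pnorm 1 (fcoef phi k).
  by rewrite sumr_ge0 // => k _; rewrite pnorm_ge0.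
have A1 : 1 <= A by rewrite lerDl.
exists (C + D)%N, A, B; split=> // k k0.
have [ks|sk] := leqP k s.
  have ks1 : (k < s.+1)%N by rewrite ltnS.
  split.
    rewrite (leq_trans (@leq_bigmax _ (fun i : 'I_s.+1 => size (fcoef phi i))
      (Ordinal ks1))) // -/D.
    by rewrite (leq_trans (leq_pmulr D k0)) // ltnW // ltnS leq_mul ?leq_addl.
  rewrite -[X in X <= _]mulr1 ler_pM ?pnorm_ge0 ?exprn_ege1 //.
  rewrite /A (bigD1 (Ordinal ks1)) //= addrCA lerDl addr_ge0 ?sumr_ge0 // => i _.
  exact: pnorm_ge0.
have := CB (k - s)%N; rewrite /v /=; move: (sk); rewrite -subn_gt0.
case Eks : (k - s)%N => [//|k'] _; rewrite -Eks subnK ?(ltnW sk) // => -[sz nm].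
split.
  by rewrite (leq_trans sz) // ltnS leq_mul ?leq_addr ?leq_subr.
rewrite (le_trans nm) // -[X in X <= _]mul1r ler_pM ?exprn_ge0 ?(le_trans ler01) //.
by rewrite ler_weXn2l ?leq_subr.
Qed.

End Norms.

(** * Convergence on sectors *)

Section Convergence.
Variable R : realType.
Local Notation C := R[i].

Lemma complex_archi (c : C) : 0 <= c -> exists N : nat, c <= N%:R.
Proof.
move=> c0; exists (Num.bound (complex.Re c)).
have cR := RRe_real (ger0_real c0).
have Rc0 : 0 <= complex.Re c by rewrite -lecR cR.
by rewrite -cR -(rmorph_nat (real_complex R)) lecR ltW // archi_boundP.
Qed.

Lemma norm_real_complex (x : R) : `|x%:C%C| = `|x|%:C%C.
Proof. by rewrite normc_def /= expr0n addr0 sqrtr_sqr. Qed.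

Lemma norm_cos_sin (x : R) : `|(cos x +i* sin x)%C| = 1 :> C.
Proof. by rewrite normc_def /= cos2Dsin2 sqrtr1. Qed.

Lemma norm_expC (z : C) : `|expC z| = (expR (complex.Re z))%:C%C.
Proof. by rewrite normrM norm_real_complex norm_cos_sin mulr1 ger0_norm ?expR_ge0. Qed.

Lemma le_Re_norm (z : C) : `|complex.Re z|%:C%C <= `|z|.
Proof. exact: normc_ge_Re. Qed.

Lemma le_Im_norm (z : C) : `|complex.Im z|%:C%C <= `|z|.
Proof.
by rewrite normc_def lecR -sqrtr_sqr ler_wsqrtr // lerDr sqr_ge0.
Qed.

Lemma le_norm_ReIm (z : C) : `|z| <= (`|complex.Re z| + `|complex.Im z|)%:C%C.
Proof.
rewrite normc_def lecR -[leRHS]ger0_norm ?addr_ge0 // -sqrtr_sqr ler_wsqrtr //.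
rewrite sqrrD !real_normK ?num_real // lerD2r lerDl.
by rewrite mulrn_wge0 ?mulr_ge0.
Qed.

Lemma geometric_tail (u : nat -> R) (A : R) :
  (forall k, (0 < k)%N -> `|u k| <= A / 2 ^+ k) ->
  forall N, (0 < N)%N -> `|limn (series u) - series u N| <= 2 * A / 2 ^+ N.
Proof.
move=> uA N N0.
have A0 : 0 <= A.
  by have := le_trans (normr_ge0 _) (uA 1%N isT); rewrite pmulr_lge0 ?invr_gt0 ?exprn_gt0.
have ucvg : cvgn (series u).
  apply: normed_cvg.
  (* The summand [|u 0|] covers index 0, where [uA] says nothing. *)
  apply: (@series_le_cvg _ _ (geometric (A + `|u 0%N|) 2^-1)) => // k.
  - exact: normr_ge0.
  - by rewrite /= mulr_ge0 ?addr_ge0 ?exprn_ge0 ?invr_ge0.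
  - case: k => [|k]; first by rewrite /= expr0 mulr1 lerDr.
    rewrite (le_trans (uA k.+1 isT)) //= exprVn ler_wpM2r ?invr_ge0 ?exprn_ge0 //.
    by rewrite lerDl.
  - by apply: is_cvg_geometric_series; rewrite ger0_norm ?invr_ge0 // invf_lt1 // ltr1n.
(* Subtracting the tail still to come makes the induction on [j] exact, since one term is at most
   half of the remaining geometric sum. *)
have tail j : `|series u (N + j)%N - series u N| <= 2 * A / 2 ^+ N - 2 * A / 2 ^+ (N + j).
  elim: j => [|j IH]; first by rewrite addn0 !subrr normr0.
  have -> : series u (N + j.+1)%N - series u N =
      series u (N + j)%N - series u N + u (N + j)%N.
    by rewrite addnS seriesSr addrAC.
  rewrite (le_trans (ler_normD _ _)) // (le_trans (lerD IH (uA _ _))) ?addn_gt0 ?N0 //.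
  have -> : 2 * A / 2 ^+ (N + j.+1) = A / 2 ^+ (N + j).
    by rewrite addnS exprS -(mulf_div 2 2) divff ?pnatr_eq0 ?mul1r.
  lra.
have close n : (N <= n)%N -> `|series u n - series u N| <= 2 * A / 2 ^+ N.
  move=> /subnKC <-; rewrite (le_trans (tail _)) // gerBl.
  by rewrite divr_ge0 ?mulr_ge0 ?exprn_ge0.
rewrite ler_distl; apply/andP; split.
- apply: limr_ge => //; near=> n.
  have /close : (N <= n)%N by near: n; exact: nbhs_infty_ge.
  by rewrite ler_distl => /andP[].
- apply: limr_le => //; near=> n.
  have /close : (N <= n)%N by near: n; exact: nbhs_infty_ge.
  by rewrite ler_distl => /andP[].
Unshelve. all: by end_near. Qed.

(** The limit is assembled from the real series of real and imaginary parts; each contributes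
    [2 A / 2 ^+ N] to a tail bound independent of [z]. *)
Lemma uniform_cvg_geometric (g : nat -> C^o -> C^o) (S : set C^o) (A : R) :
  (forall z k, S z -> (0 < k)%N -> `|g k z| <= (A / 2 ^+ k)%:C%C) ->
  exists f : C^o -> C^o,
    {uniform S, (fun N z => \sum_(k < N) g k z) @ \oo --> f}.
Proof.
move=> gA; pose re z k := complex.Re (g k z); pose im z k := complex.Im (g k z).
exists (fun z => (limn (series (re z)) +i* limn (series (im z)))%C).
have sumE N z : \sum_(k < N) g k z = (series (re z) N +i* series (im z) N)%C.
  rewrite /series /= !big_mkord; elim: N => [|N IH]; first by rewrite !big_ord0.
  by rewrite !big_ord_recr /= IH /re /im; case: (g N z).
have close z N : S z -> (0 < N)%N ->
    `|(limn (series (re z)) +i* limn (series (im z)))%C - \sum_(k < N) g k z|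
      <= (4 * A / 2 ^+ N)%:C%C.
  move=> Sz N0; rewrite sumE (le_trans (le_norm_ReIm _)) // lecR /=.
  have -> : 4 * A / 2 ^+ N = 2 * A / 2 ^+ N + 2 * A / 2 ^+ N by lra.
  apply: lerD; apply: geometric_tail => // k k0; rewrite -lecR.
    by rewrite (le_trans (le_Re_norm _)) ?gA.
  by rewrite (le_trans (le_Im_norm _)) ?gA.
move=> P /uniform_nbhs[E [entE EP]].
move: entE; rewrite -entourage_ballE => -[e /= e0 eE].
have eR := RRe_real (ger0_real (ltW e0)).
have Re0 : 0 < complex.Re e by rewrite -ltcR eR.
have half : `|2^-1 : R| < 1 by rewrite ger0_norm ?invr_ge0 // invf_lt1 // ltr1n.
have /cvgrPdist_lt/(_ _ Re0) small := cvg_geometric (4 * A) half.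
near=> N.
apply: EP => z Sz; apply: eE; rewrite /= -ball_normE /=.
have N0 : (0 < N)%N by near: N; exact: nbhs_infty_gt.
rewrite (le_lt_trans (close z N Sz N0)) // -eR ltcR.
have : `|0 - geometric (4 * A) 2^-1 N| < complex.Re e by near: N.
by rewrite sub0r normrN /= exprVn; apply: le_lt_trans; exact: ler_norm.
Unshelve. all: by end_near. Qed.

(* Since [exp u >= (u / (D + 1)) ^ (D + 1)], the quantity [u ^ D * exp (- u)] is at
   most of order [1 / u]. *)
Lemma log_power_small (M B : R) (D : nat) : 0 <= M -> 0 < B ->
  exists2 rho0 : R, 0 < rho0 & forall x, 0 < x <= rho0 ->
    ln x <= 0 /\ 2 * B * ((1 + M - ln x) ^+ D * x) <= 1.
Proof.
move=> M0 B0; pose c : R := D.+1%:R ^+ D.+1; pose E := expR (1 + M).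
have c0 : 0 < c by rewrite exprn_gt0.
have E0 : 0 < E by exact: expR_gt0.
have U0 : 0 < 2 * B * c * E by rewrite !mulr_gt0.
(* The radius is chosen so that [u = 1 + M - ln x] is at least [2 B c E]; together with
   [u ^+ D.+1 <= c * expR u] and [x * expR u = E] this gives the bound. *)
exists (expR (- (2 * B * c * E))) => [|x /andP[x0 xle]]; first exact: expR_gt0.
have lnx : ln x <= - (2 * B * c * E).
  by rewrite -(expRK (- _)) ler_ln ?posrE ?expR_gt0.
split; first by rewrite (le_trans lnx) // oppr_le0 ltW.
set u := 1 + M - ln x.
have uU : 2 * B * c * E <= u by rewrite /u; lra.
have u0 : 0 < u by exact: lt_le_trans uU.
have xE : x * expR u = E.
  by rewrite /u expRD mulrCA expRN lnK ?posrE // divff ?gt_eqF // mulr1.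
have uD : u ^+ D.+1 <= c * expR u.
  have -> : u = D.+1%:R * (u / D.+1%:R) by rewrite mulrC divfK ?pnatr_eq0.
  rewrite expRM_natl exprMn ler_pM2l // lerXn2r ?nnegrE ?expR_ge0 //.
    by rewrite divr_ge0 // ltW.
  by rewrite (le_trans _ (expR_ge1Dx _)) // lerDr.
rewrite -(ler_pM2r (mulr_gt0 c0 E0)) mul1r.
have -> : 2 * B * (u ^+ D * x) * (c * E) = (2 * B * c * E) * (u ^+ D * x) by ring.
apply: (@le_trans _ _ (u * (u ^+ D * x))).
  by rewrite ler_wpM2r // mulr_ge0 ?exprn_ge0 // ltW.
by rewrite mulrA -exprS -xE mulrCA mulrC ler_wpM2l // ltW.
Qed.

End Convergence.

Theorem theorem1 (R : realType) (n : nat) (F : {mpoly R[i][n.+2]})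
    (phi : dulac R[i]) (m : nat) (a : 'I_n.+1 -> R[i])
    (b : 'I_n.+1 -> {poly R[i]})
    (hphi : eval_jet F phi = 0)
    (hF : forall j : 'I_n.+1,
        starts_with m (a j) (b j) (eval_jet (F^`M(lift ord0 j)) phi))
    (ha : a ord_max != 0) :
  (* The radius bound rho0 is the same for all sectors S and all branches L
     of ln on S with `|Im L| <= M. *)
  forall M : R, exists2 rho0 : R, 0 < rho0 &
    forall rho alpha beta : R, 0 < rho <= rho0 ->
    0 < beta - alpha < 2 * pi ->
    forall L : R[i]^o -> R[i]^o, log_branch (sector rho alpha beta) L ->
    (forall z, sector rho alpha beta z -> `|complex.Im (L z)| <= M) ->
    dulac_ucvg phi L (sector rho alpha beta).
Proof.
move=> M.
have [D [A [B [A1 B1 bound]]]] := dulac_growth (@complex_archi R) hphi hF ha.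
have AE : A = (complex.Re A)%:C%C by rewrite RRe_real // ger0_real // (le_trans ler01).
have BE : B = (complex.Re B)%:C%C by rewrite RRe_real // ger0_real // (le_trans ler01).
have B0 : 0 < complex.Re B by rewrite -ltcR -BE (lt_le_trans ltr01).
have [rho0 rho00 small] := log_power_small D (normr_ge0 M) B0.
exists rho0 => // rho alpha beta /andP[_ rhole] _ L [_ expL] ImL.
apply: (@uniform_cvg_geometric R (fun k z => (fcoef phi k).[L z] * z ^+ k) _
  (complex.Re A)) => z k Sz k0.
have [r [theta [/andP[r0 rrho] _ zE]]] := Sz.
have rle : 0 < r <= rho0 by rewrite r0 (le_trans (ltW rrho)).
have zr : `|z| = r%:C%C by rewrite zE normrM norm_real_complex norm_cos_sin mulr1 gtr0_norm.
(* The modulus of [exp (L z)] determines the real part of [L z], whatever the branch. *)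
have ReL : complex.Re (L z) = ln r.
  have := norm_expC (L z); rewrite expL // zr => /(congr1 (@complex.Re R)) /= ->.
  by rewrite expRK.
(* [T] bounds [|L z|], and its summand 1 gives [1 <= T], so every power of ln x in p_k is dominated
   by [T ^+ (D * k)]. *)
have [lnr0 rsmall] := small r rle; pose T := 1 + `|M| - ln r.
have LT : `|L z| <= T%:C%C.
  rewrite (le_trans (le_norm_ReIm _)) // lecR ReL ler0_norm // /T.
  have := le_trans (ImL z Sz) (ler_norm M); lra.
have T1 : 1 <= T by rewrite /T; have := normr_ge0 M; lra.
have [sz nm] := bound k k0.
rewrite normrM normrX zr.
have T1C : 1 <= T%:C%C :> R[i] by rewrite -(rmorph1 (real_complex R)) lecR.
have evalle : `|(fcoef phi k).[L z]| <= A * B ^+ k * T%:C%C ^+ (D * k).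
  rewrite (le_trans (norm_horner_le _ _)) //.
  rewrite (le_trans (pnorm_mono _ (_ : 0 <= `|L z| <= T%:C%C))) ?normr_ge0 //.
  rewrite (le_trans (pnorm_scale T1C sz)) // ler_wpM2r // exprn_ge0 //.
  exact: le_trans T1C.
have r0C : 0 <= r%:C%C ^+ k :> R[i] by rewrite exprn_ge0 // lecR ltW.
rewrite (le_trans (ler_wpM2r r0C evalle)) //.
(* The k-th term is at most [A (B T^D r)^k], and [rsmall] says that the ratio [B T^D r] is at most
   1/2. *)
have -> : A * B ^+ k * T%:C%C ^+ (D * k) * r%:C%C ^+ k =
    (complex.Re A * (complex.Re B * (T ^+ D * r)) ^+ k)%:C%C.
  by rewrite AE BE -!(rmorphXn (real_complex R)) -!rmorphM /= exprM !exprMn !mulrA.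
rewrite lecR -exprVn.
apply: ler_wpM2l; first by rewrite -lecR -AE (le_trans ler01).
rewrite lerXn2r ?nnegrE ?invr_ge0 //.
  by rewrite !mulr_ge0 ?exprn_ge0 ?(ltW B0) ?(le_trans _ T1) ?(ltW r0).
by rewrite -div1r ler_pdivlMr // mulrC mulrA.
Qed.
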